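(* Let $p$ be a prime, let $n$ be a positive integer, and let $G = \langle x_1\rangle\times \langle x_2\rangle \times \cdots\times \langle x_n\rangle$ be a finite abelian $p$-group (the internal direct product of the cyclic subgroups generated by elements $x_1,\dots,x_n\in G$), where $|x_r| = p^{m_r}$ for $1\le r\le n$ and $1\le m_1 \leq m_2 \leq \cdots \leq m_n$. Let $g = \prod_{\alpha=1}^{n} x_\alpha^{i_\alpha}$ (with integers $i_\alpha$) be a non-identity element of $G$, and write $|x_\alpha^{i_\alpha}|=p^{t_\alpha}$ for $1\le\alpha\le n$. Let $k$ be the smallest non-negative integer such that $|x_{k+1}^{i_{k+1}}| \neq 1$. Then \[d_G^-(g)=-1+\phi(|g|) \sum_{\beta=0}^{\min\{m_{k+1}-t_{k+1},\ldots,m_n-t_n\}}p^{\left(\sum_{j=1}^{n} \min\{m_j, \beta\}\right)}.\]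
   Context: Groups are finite, non-trivial and written multiplicatively. For $g\in G$, $|g|$ is the order of $g$ and $\langle g\rangle$ is the cyclic subgroup generated by $g$; $\phi$ is Euler's totient function. The directed power graph $\overrightarrow{\mathcal{G}}(G)$ of a group $G$ is the digraph with vertex set $G$ in which there is an edge from a vertex $u$ to a different vertex $v$ whenever $v$ is a power of $u$. The in-degree $d_G^-(g)$ is the number of edges with head $g$ in $\overrightarrow{\mathcal{G}}(G)$; that is, $d_G^-(g) = |\{h\in G : h\neq g \text{ and } g \in \langle h \rangle\}|$. *)

(* Defs.v *)
From mathcomp Require Import all_boot all_order all_algebra all_fingroup all_solvable.

Set Implicit Arguments.
Unset Strict Implicit.
Unset Printing Implicit Defensive.

Import GroupScope.

(* fingroup only has powers with exponents in nat. *)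
Definition expgz (gT : finGroupType) (x : gT) (z : int) : gT :=
  match z with
  | Posz n => x ^+ n
  | Negz n => x ^- n.+1
  end.

Definition indegree (T : finType) (e : rel T) (v : T) : nat :=
  #|[set u | e u v]|.

(* Edge relation of the directed power graph of G; the elements of the ambient
   gT outside G are not vertices, so no edge touches them. *)
Definition dpower_graph (gT : finGroupType) (G : {group gT}) : rel gT :=
  fun u v => [&& u \in G, v \in G, u != v & v \in <[u]>].

(* Main.v *)
Require Import Defs.
From mathcomp Require Import all_boot all_order all_algebra all_fingroup all_solvable.
From mathcomp Require Import zify.

(* Let g <> 1.  If g lies in <h>, there is exactly one b such that h ^ (p ^ b)
   generates <g>, so the h with g in <h> are counted by b and by the generator
   g' = h ^ (p ^ b) of <g>.  For given b and g', such an h exists iff g is a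
   (p ^ b)-th power, i.e. g lies in 'Mho^b(G), and then the solutions form a
   coset of the kernel 'Ohm_b(G) of the (p ^ b)-th power map.  Both 'Mho^b and
   'Ohm_b are computed factor by factor in the direct decomposition of G. *)

Section PowerGraph.

Set Implicit Arguments.
Unset Strict Implicit.
Local Open Scope group_scope.

Lemma leq_bigmin (I : Type) (r : seq I) (P : pred I) (F : I -> nat) (x0 b : nat) :
  (b <= \big[minn/x0]_(i <- r | P i) F i)
  = (b <= x0) && all (fun i => P i ==> (b <= F i)) r.
Proof.
elim: r => [|i r IH]; first by rewrite big_nil andbT.
by rewrite big_cons /=; case: (P i); rewrite //= leq_min IH andbCA.
Qed.

Lemma expgz_in_cycle (gT : finGroupType) (x : gT) (z : int) : expgz x z \in <[x]>.
Proof. by case: z => n /=; rewrite ?groupV mem_cycle. Qed.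

Lemma Ohm_bigdprod (b : nat) (gT : finGroupType) (I : Type) (r : seq I)
    (P : pred I) (A : I -> {set gT}) (G : {group gT}) :
  \big[dprod/1]_(i <- r | P i) A i = G ->
  \big[dprod/1]_(i <- r | P i) 'Ohm_b(A i) = 'Ohm_b(G).
Proof.
elim: r G => [|i r IH] G; first by rewrite !big_nil => <-; rewrite Ohm1.
rewrite !big_cons; case: (P i); last exact: IH.
move=> defG; have [[_ H _ defH] _ _ _] := dprodP defG.
by rewrite defH in defG; rewrite (IH H defH) (Ohm_dprod b defG).
Qed.

Lemma Mho_bigdprod (b : nat) (gT : finGroupType) (I : Type) (r : seq I)
    (P : pred I) (A : I -> {set gT}) (G : {group gT}) :
  \big[dprod/1]_(i <- r | P i) A i = G ->
  \big[dprod/1]_(i <- r | P i) 'Mho^b(A i) = 'Mho^b(G).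
Proof.
elim: r G => [|i r IH] G; first by rewrite !big_nil => <-; rewrite Mho1.
rewrite !big_cons; case: (P i); last exact: IH.
move=> defG; have [[_ H _ defH] _ _ _] := dprodP defG.
by rewrite defH in defG; rewrite (IH H defH) (Mho_dprod b defG).
Qed.

(** Subgroups of the cyclic group [<[h]>] are determined by their orders, and [h ^+ (p ^ b)] has
    order [p ^ (a - b)] when [h] has order [p ^ a]. As [g != 1], the truncated subtraction [a - b]
    is positive and so determines [b]. *)
Lemma generator_expg_p (p : nat) (gT : finGroupType) (g h : gT) (b : nat) :
  prime p -> p.-elt h -> g != 1 ->
  generator <[g]> (h ^+ (p ^ b))
  = (g \in <[h]>) && (b == logn p #[h] - logn p #[g])%N.
Proof.
move=> p_pr /p_natP[a oh] ntg.
have ohX := orderXexp b oh.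
rewrite /generator oh pfactorK //; apply/eqP/andP => [defg | [gh /eqP ->]].
  have ogX : #[g] = (p ^ (a - b))%N by rewrite -ohX /order -defg.
  split; first by rewrite -cycle_subG defg cycle_subG mem_cycle.
  rewrite ogX pfactorK // subKn //; rewrite -order_gt1 ogX in ntg.
  by apply: ltnW; rewrite -subn_gt0; case: (a - b)%N ntg.
have /p_natP[c og] : p.-nat #[g].
  by apply: pnat_dvd (order_dvdG gh) _; rewrite -orderE oh pnatX pnat_id.
have le_ca : c <= a.
  by rewrite -(dvdn_Pexp2l _ _ (prime_gt1 p_pr)) -og -oh order_dvdG.
apply/eqP; rewrite (eq_subG_cyclic (cycle_cyclic h)) ?cycle_subG ?mem_cycle //.
by rewrite -!orderE og pfactorK // (orderXexp _ oh) subKn.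
Qed.

Lemma card_expg_fiber (p : nat) (gT : finGroupType) (G : {group gT}) (z : gT) (b : nat) :
  abelian G -> p.-group G -> z \in 'Mho^b(G) ->
  #|[set h in G | h ^+ (p ^ b) == z]| = #|'Ohm_b(G)|.
Proof.
move=> abG pG; rewrite (MhoEabelian _ pG abG) => /imsetP[h0 Gh0 ->].
(* The fiber is the translate of the kernel by one root [h0] of [z]. *)
rewrite (OhmEabelian pG (abelianS (Ohm_sub b G) abG)) -(card_lcoset 'Ldiv_(p ^ b)(G) h0).
apply: eq_card => h; rewrite mem_lcoset inE; apply/andP/LdivP.
  case=> Gh /eqP eqh; rewrite groupM ?groupV //; split=> //.
  have cVh : commute h0^-1 h by apply: (centsP abG); rewrite ?groupV.
  by rewrite expgMn // eqh expVgn mulVg.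
case=> Gh eqh; have Gh' : h \in G by rewrite -(groupMl _ (groupVr Gh0)).
split=> //; apply/eqP; rewrite -[h in LHS](mulKVg h0).
have c0h : commute h0 (h0^-1 * h) by apply: (centsP abG).
by rewrite expgMn // eqh mulg1.
Qed.

Lemma card_mem_cycle (p : nat) (gT : finGroupType) (G : {group gT}) (g : gT) (N : nat) :
  prime p -> abelian G -> p.-group G -> g \in G -> g != 1 ->
  (forall b, (g \in 'Mho^b(G)) = (b < N)) ->
  #|[set h in G | g \in <[h]>]|
  = (totient #[g] * \sum_(0 <= b < N) #|'Ohm_b(G)|)%N.
Proof.
move=> p_pr abG pG Gg ntg MhoN; rewrite totient_gen mulnC big_distrl /= big_mkord.
pose e (h : gT) := (logn p #[h] - logn p #[g])%N.
have pE h : h \in G -> p.-elt h by apply: mem_p_elt pG.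
have genE h b : h \in G ->
    generator <[g]> (h ^+ (p ^ b)) = (g \in <[h]>) && (b == e h).
  by move=> Gh; apply: generator_expg_p (pE h Gh) ntg.
have MhoP h b : h \in G -> generator <[g]> (h ^+ (p ^ b)) -> b < N.
  move=> Gh gen; rewrite -MhoN -cycle_subG (eqP gen) cycle_subG.
  by rewrite /= (MhoEabelian _ pG abG); apply: imset_f.
(* [N = 0] is impossible because [g] lies in ['Mho^0(G)], which is [G]; a successor bound makes
   [inord] available below. *)
rewrite -sum1_card; case: N MhoN MhoP => [|N] MhoN MhoP.
  by have := MhoN 0; rewrite Mho0 Gg.
rewrite (partition_big (fun h => inord (e h) : 'I_N.+1) predT) //=.
apply: eq_bigr => b _.
transitivity (\sum_(h in [set h in G | generator <[g]> (h ^+ (p ^ b))]) 1)%N.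
  apply: eq_bigl => h; rewrite !inE -andbA; apply: andb_id2l => Gh.
  rewrite genE //; apply: andb_id2l => gh.
  (* This bound ensures that [inord] does not alter [e h]. *)
  have ltN : e h < N.+1 by apply: (MhoP h) => //; rewrite genE // gh /=.
  by rewrite -val_eqE /= inordK // eq_sym.
rewrite (partition_big (fun h => h ^+ (p ^ b)) (generator <[g]>)) /=; last first.
  by move=> h; rewrite inE => /andP[].
rewrite -[#|[set x | _]|]sum1_card big_distrr /= [RHS]big_mkcond /= big_mkcond /=.
apply: eq_bigr => z _; rewrite inE; case: ifP => // gen.
rewrite muln1 -(@card_expg_fiber p _ _ z) //; last first.
  by rewrite -cycle_subG -(eqP gen) cycle_subG MhoN.
rewrite sum1_card; apply: eq_card => h; rewrite unfold_in /= !inE.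
by case: eqP => [->|_]; rewrite ?gen ?andbT ?andbF.
Qed.

Section BigCycle.

Variables (p n : nat) (gT : finGroupType) (G : {group gT}).
Variables (x : 'I_n -> gT) (m : 'I_n -> nat).
Hypotheses (p_pr : prime p) (defG : \big[dprod/1]_(r < n) <[x r]> = G).
Hypothesis ox : forall r, #[x r] = (p ^ m r)%N.

Let px r : p.-elt (x r).
Proof. by rewrite /p_elt ox pnatX pnat_id. Qed.

Lemma card_Ohm_bigcycle b :
  #|'Ohm_b(G)| = (p ^ (\sum_(j < n) minn (m j) b))%N.
Proof.
rewrite -(bigdprod_card (Ohm_bigdprod b defG)) expn_sum; apply: eq_bigr => r _.
(* The factor's ['Ohm_b] is generated by [x r ^+ (p ^ (m r - b))], of order
   [p ^ (m r - (m r - b))]. *)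
rewrite (Ohm_p_cycle _ (px r)) -orderE ox pfactorK //.
by rewrite (orderXexp _ (ox r)) minnE.
Qed.

(** Membership is tested in each cyclic factor, where it only compares orders. By truncation, a
    trivial component imposes no condition. *)
Lemma mem_Mho_bigcycle (y : 'I_n -> gT) (t : 'I_n -> nat) b :
    (forall r, y r \in <[x r]>) -> (forall r, #[y r] = (p ^ t r)%N) ->
  (\prod_(r < n) y r \in 'Mho^b(G)) = [forall r, t r <= m r - b].
Proof.
move=> xy oy; have Mx r := Mho_p_cycle b (px r).
have Gx r : <[x r]> \subset G.
  by rewrite -(bigdprodWY defG) sub_gen // (bigcup_max r).
have memMx r : (y r \in 'Mho^b(<[x r]>)) = (t r <= m r - b).
  rewrite Mx -cycle_subG -(cardSg_cyclic (cycle_cyclic (x r))) ?cycle_subG ?mem_cycle //.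
  by rewrite -!orderE oy (orderXexp _ (ox r)) dvdn_Pexp2l ?prime_gt1.
apply/idP/forallP => [Mg r | le_tm].
  (* The components [c] of the product in ['Mho^b(G)] must be the [y r], since decompositions in [G]
     are unique. *)
  have [c [Mc defg _]] := mem_bigdprod (Mho_bigdprod b defG) Mg.
  have Gg : \prod_(r < n) y r \in G := subsetP (Mho_sub b G) _ Mg.
  have [d [_ _ uniq_d]] := mem_bigdprod defG Gg.
  have xc s : true -> c s \in <[x s]>.
    by move=> _; apply: (subsetP (Mho_sub b _)); apply: Mc.
  rewrite -memMx (uniq_d y) // -(uniq_d c) //; exact: Mc.
rewrite -(bigdprodW (Mho_bigdprod b defG)).
apply: mem_prodg => r _; rewrite memMx; exact: le_tm.
Qed.

End BigCycle.

End PowerGraph.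

(* Indices run over 'I_n, that is from 0: the element x k with k : 'I_n is
   x_(k+1) in the usual numbering, so k is the same integer in both.
   The initial value in the iterated minimum is its term of index k. *)
Theorem theorem3p2 (p : nat) (p_prime : prime p) (n : nat) (n_gt0 : 0 < n)
  (gT : finGroupType) (G : {group gT}) (abG : abelian G) (pG : (p.-group G)%g)
  (x : 'I_n -> gT) (m : 'I_n -> nat)
  (defG : (\big[dprod/1]_(r < n) <[x r]>)%g = G)
  (ox : forall r : 'I_n, #[x r]%g = p ^ m r)
  (m_gt0 : forall r : 'I_n, 1 <= m r)
  (m_sorted : forall r s : 'I_n, r <= s -> m r <= m s)
  (g : gT) (i : 'I_n -> int) (t : 'I_n -> nat)
  (defg : g = (\prod_(a < n) expgz (x a) (i a))%g)
  (g_neq1 : g <> 1%g)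
  (ot : forall a : 'I_n, #[expgz (x a) (i a)]%g = p ^ t a)
  (k : 'I_n)
  (k_ord : #[expgz (x k) (i k)]%g <> 1)
  (k_min : forall j : 'I_n, #[expgz (x j) (i j)]%g <> 1 -> k <= j) :
  ((indegree (dpower_graph G) g)%:Z
   = -1 + (totient #[g]%g
           * \sum_(0 <= b < (\big[minn/(m k - t k)]_(a < n | k <= a) (m a - t a)).+1)
               p ^ (\sum_(j < n) minn (m j) b))%N%:Z)%R.
Proof.
have p_gt1 := prime_gt1 p_prime.
pose y a := expgz (x a) (i a).
have xy a : (y a \in <[x a]>)%g := expgz_in_cycle _ _.
have le_tm a : t a <= m a.
  by rewrite -(dvdn_Pexp2l _ _ p_gt1) -ot -ox order_dvdG // xy.
have t_gt0 a : #[y a]%g <> 1 <-> 0 < t a.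
  rewrite ot lt0n -(inj_eq (expnI p_gt1)).
  by split=> /eqP.
have MhoN b : (g \in 'Mho^b(G))%g
    = (b < (\big[minn/(m k - t k)]_(a < n | k <= a) (m a - t a)).+1).
  rewrite defg (mem_Mho_bigcycle p_prime defG ox b xy ot) ltnS leq_bigmin.
  have b_tm a : (0 < t a) -> (t a <= m a - b) = (b <= m a - t a).
    by move=> ta; have := le_tm a; lia.
  apply/forallP/andP => [le_t | [le_k /allP le_a] a].
    have le_bk : b <= m k - t k by rewrite -b_tm //; apply/t_gt0.
    split=> //; apply/allP => a _; apply/implyP => le_ka.
    have [ta0 | ta] := posnP (t a); last by rewrite -b_tm.
    (* A trivial component after [k] contributes [m a] to the minimum; as the [m] are sorted, this
       is at least the term of index [k]. *)
    rewrite ta0 subn0; apply: leq_trans le_bk _.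
    by apply: leq_trans (leq_subr _ _) (m_sorted _ _ le_ka).
  have [-> // | ta] := posnP (t a); rewrite b_tm //.
  apply: (implyP (le_a a (mem_index_enum a))).
  exact/k_min/t_gt0.
have Gg : g \in G.
  by have := MhoN 0; rewrite Mho0.
have ntg : g != 1%g by apply/eqP.
(* The graph has no loops, so [g] itself is left out of the count; this gives the [-1]. *)
have -> : indegree (dpower_graph G) g = #|[set h in G | g \in <[h]>%g] :\ g|.
  by apply: eq_card => h; rewrite !inE /dpower_graph Gg; case: (h \in G); rewrite ?andbF.
have := cardsD1 g [set h in G | g \in <[h]>%g].
rewrite (card_mem_cycle p_prime abG pG Gg ntg MhoN) inE Gg cycle_id /=.
rewrite (eq_bigr _ (fun b _ => card_Ohm_bigcycle p_prime defG ox b)) => ->.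
by rewrite PoszD GRing.addKr.
Qed.
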